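(* Let $\mathcal{G}=(V,E,F)$ be a locally finite planar straight line graph tiling the plane $\mathbb{R}^2$, given in half-edge representation, let $e_{\mathrm{init}}\in E$ be any starting half-edge and let $p\in\mathbb{R}^2$ be any query point. Consider the following nondeterministic procedure (the Abstract Walk): 1. Set $e\gets e_{\mathrm{init}}$. If $p$ lies strictly to the right of $e$, set $e\gets \mathrm{twin}(e)$. 2. Set $E'\gets\{e\}$. 3. While $E'\neq\varnothing$: choose an arbitrary $e\in E'$ and set $E'\gets\{\mathrm{twin}(e')\ :\ e' \text{ is a half-edge on the perimeter of } \mathrm{face}(e),\ D(e',p)<D(e,p),\ p \text{ strictly right of } e'\}$. 4. Return $\mathrm{face}(e)$. Then, for every choice made in step 3, the procedure terminates after finitely many iterations, and upon termination $p\in \mathrm{face}(e)$.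
   Context: A planar straight line graph (PSLG) $\mathcal{G}=(V,E,F)$ consists of vertices $V$ (points of $\mathbb{R}^2$), half-edges $E$ (directed straight line segments), and faces $F$ (regions of the plane, regarded as closed point sets). It is assumed to tile the entire plane (no outer boundary) and to be locally finite: every bounded region of the plane meets only finitely many vertices, edges and faces. In half-edge representation one has maps $\mathrm{origin},\mathrm{target}:E\to V$ (start and end vertex of a half-edge), $\mathrm{face}:E\to F$ (the face lying to the left of the half-edge), $\mathrm{next}:E\to E$ (the successor half-edge in counter-clockwise order along the perimeter of the face), and $\mathrm{twin}:E\to E$ (the half-edge with the same underlying segment in the opposite direction, so $\mathrm{twin}(\mathrm{twin}(e))=e$, $\mathrm{origin}(e)=\mathrm{target}(\mathrm{twin}(e))$ and vice versa). The half-edges on the perimeter of a face $f$ are those $e$ with $\mathrm{face}(e)=f$. ''$p$ strictly right of $e$'' means $p$ lies strictly on the right side of the directed line through $e$ (oriented from $\mathrm{origin}(e)$ to $\mathrm{target}(e)$). Celestial distance: for $p\in\mathbb{R}^2$ and a half-edge $e$, let $q$ be the point of the segment $e$ closest to $p$ and $d=|pq|$. Define $D(e,p)=[d,\alpha]$, where $\alpha=0$ if $d=0$, and otherwise $\alpha$ is the wide angle ($\alpha\ge \pi/2$) between the edge $e$ and the segment $qp$ (so $\alpha=\pi/2$ if $q$ is interior to $e$, and if $q$ is an endpoint of $e$, $\alpha$ is the angle at $q$ between $e$ and $qp$). Celestial distances are compared lexicographically: $[d,\alpha]<[d',\alpha']$ iff $d<d'$, or $d=d'$ and $\alpha<\alpha'$.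 *)

(* Defs.v *)
From HB Require Import structures.
From mathcomp Require Import all_boot all_order all_algebra.
From mathcomp Require Import all_classical all_reals all_analysis.

Set Implicit Arguments.
Unset Strict Implicit.
Unset Printing Implicit Defensive.

Import Order.TTheory GRing.Theory Num.Theory.
Import numFieldNormedType.Exports.

Local Open Scope classical_set_scope.
Local Open Scope ring_scope.

(* The plane is R * R.  Its library norm is the max norm, which is used only
   for topology and boundedness; metric notions use [enorm]. *)

Definition dot (R : realType) (u v : R * R) : R := u.1 * v.1 + u.2 * v.2.

Definition cross (R : realType) (u v : R * R) : R := u.1 * v.2 - u.2 * v.1.

Definition enorm (R : realType) (u : R * R) : R := Num.sqrt (dot u u).

Definition dist (R : realType) (a b : R * R) : R := enorm (b - a).

Definition vangle (R : realType) (u v : R * R) : R :=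
  acos (dot u v / (enorm u * enorm v)).

Definition scale (R : realType) (t : R) (u : R * R) : R * R :=
  (t * u.1, t * u.2).

Definition rotate (R : realType) (theta : R) (u : R * R) : R * R :=
  (cos theta * u.1 - sin theta * u.2, sin theta * u.1 + cos theta * u.2).

Definition left_normal (R : realType) (u : R * R) : R * R := (- u.2, u.1).

Definition segment (R : realType) (a b : R * R) : set (R * R) :=
  [set x | exists2 t : R, 0 <= t <= 1 & x = a + scale t (b - a)].

Definition open_segment (R : realType) (a b : R * R) : set (R * R) :=
  [set x | exists2 t : R, 0 < t < 1 & x = a + scale t (b - a)].

(* Turning counter-clockwise from the direction of [u], the direction of [v]
   is met strictly before that of [w] is first met.  When [u] and [w] have the
   same direction the turn is a full one. *)
Definition ccw_strictly_between (R : realType) (u v w : R * R) : Prop :=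
  exists theta phi r s : R,
    [/\ 0 < theta, theta < phi, phi <= 2 * pi, 0 < r /\ 0 < s &
        v = scale r (rotate theta u) /\ w = scale s (rotate phi u)].

(* Locally finite planar straight line graphs tiling the plane, in half-edge
   representation.  Faces may be non-convex, unbounded, or multiply connected,
   and dangling edges ([next e = twin e]) are allowed. *)
Record pslg (R : realType) := PSLG {
  vertex : Type;
  halfedge : Type;
  facet : Type;
  pos : vertex -> R * R;
  region : facet -> set (R * R);
  origin : halfedge -> vertex;
  target : halfedge -> vertex;
  face : halfedge -> facet;
  next : halfedge -> halfedge;
  twin : halfedge -> halfedge;

  edge_set := fun e : halfedge => segment (pos (origin e)) (pos (target e));
  dir := fun e : halfedge => pos (target e) - pos (origin e);
  skeleton := range pos `|` \bigcup_(e in [set: halfedge]) edge_set e;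

  pos_inj : injective pos;
  twinK : involutive twin;
  origin_twin : forall e, origin (twin e) = target e;
  target_twin : forall e, target (twin e) = origin e;
  edge_nondegenerate : forall e, origin e <> target e;
  vertex_on_edge : forall v e, edge_set e (pos v) ->
    v = origin e \/ v = target e;
  edges_planar : forall e e' x, edge_set e x -> edge_set e' x ->
    e' = e \/ e' = twin e \/
    exists v, [/\ pos v = x, v = origin e \/ v = target e
                           & v = origin e' \/ v = target e'];

  (* Faces are the closures of the regions into which the plane is cut by the
     graph; together they cover the plane, so each such region is a face. *)
  region_component : forall f, exists2 x, ~ skeleton x &
    region f = closure (connected_component (~` skeleton) x);
  region_inj : injective region;
  region_cover : forall x, exists f, region f x;

  face_left : forall e x, open_segment (pos (origin e)) (pos (target e)) x ->
    \forall t \near 0^'+, region (face e) (x + scale t (left_normal (dir e)));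

  (* The interior of a face lies to the left of its perimeter, so at
     [target e] the sector swept counter-clockwise from [next e] to [twin e]
     belongs to [face e] and contains no other half-edge. *)
  origin_next : forall e, origin (next e) = target e;
  face_next : forall e, face (next e) = face e;
  next_ccw : forall e g, origin g = target e ->
    ~ ccw_strictly_between (dir (next e)) (dir g) (dir (twin e));

  finite_vertices : forall B : set (R * R), bounded_set B ->
    finite_set [set v | B (pos v)];
  finite_edges : forall B : set (R * R), bounded_set B ->
    finite_set [set e | edge_set e `&` B !=set0];
  finite_faces : forall B : set (R * R), bounded_set B ->
    finite_set [set f | region f `&` B !=set0]
}.

Arguments pos {R p}.
Arguments region {R p}.
Arguments origin {R p}.
Arguments target {R p}.
Arguments face {R p}.
Arguments next {R p}.
Arguments twin {R p}.
Arguments edge_set {R p}.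
Arguments dir {R p}.

Section Walk.
Variables (R : realType) (G : pslg R).
Implicit Types (e : halfedge G) (p q : R * R).

Definition strictly_right e p : Prop :=
  cross (dir e) (p - pos (origin e)) < 0.

Definition is_closest e p q : Prop :=
  edge_set e q /\ forall z, edge_set e z -> dist p q <= dist p z.

Definition closest e p : R * R := xget p [set q | is_closest e p q].

(* At an endpoint [q] of [e] there is one angle between [e] and the segment
   from [q] to [p]; at an interior point there are two supplementary ones, and
   the wide one is the larger. *)
Definition wide_angle e p q : R :=
  let a := vangle (pos (origin e) - q) (p - q) in
  let b := vangle (pos (target e) - q) (p - q) in
  if q == pos (origin e) then b
  else if q == pos (target e) then a
  else Num.max a b.

Definition celestial e p : R * R :=
  let q := closest e p in
  let d := dist p q in
  (d, if d == 0 then 0 else wide_angle e p q).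

Definition celestial_lt (D D' : R * R) : Prop :=
  D.1 < D'.1 \/ D.1 = D'.1 /\ D.2 < D'.2.

Definition candidates p e : set (halfedge G) :=
  [set twin e' | e' in
    [set e' | [/\ face e' = face e,
                  celestial_lt (celestial e' p) (celestial e p) &
                  strictly_right e' p]]].

(* A state of the walk is the pair of the current values of [e] and [E']. *)
Definition state : Type := (halfedge G * set (halfedge G))%type.

Definition initial_edge (einit : halfedge G) p : halfedge G :=
  if `[< strictly_right einit p >] then twin einit else einit.

Definition initial_state (einit : halfedge G) p : state :=
  let e := initial_edge einit p in (e, [set e]).

(* One iteration of the loop; it is enabled exactly when [E'] is nonempty. *)
Definition iteration p (s s' : state) : Prop :=
  s.2 s'.1 /\ s'.2 = candidates p s'.1.

Inductive reachable (einit : halfedge G) p : state -> Prop :=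
| reachable_init : reachable einit p (initial_state einit p)
| reachable_step s s' :
    reachable einit p s -> iteration p s s' -> reachable einit p s'.

Definition infinite_run (einit : halfedge G) p (run : nat -> state) : Prop :=
  run 0%N = initial_state einit p /\
  forall n, iteration p (run n) (run n.+1).

End Walk.

(* Main.v *)
(* Termination: the celestial distance strictly decreases along the walk, and by
   local finiteness only finitely many edges come within a given distance of p.

   Correctness: let e be a half-edge with p not strictly on its right, and
   suppose that p is not in f = face e.  Let q be the point of e closest to p.
   Choose a point y of f near q, strictly left of e, such that the line py
   avoids every vertex other than p.  Following [y, p] from p, let x be the
   first point that lies in f.  By the choice of y, x is interior to an edge e'
   crossed transversally; comparing the two half-discs around x shows that e'
   has f on its left and p strictly on its right.  If x is closer to p than q,
   then so is e'.  Otherwise x is near q, so e' contains q by local finiteness;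
   e' is not e because x is strictly left of e, so q is a common vertex, and
   since x - q points strictly inside the angle between e and p - q, the wide
   angle at q is smaller for e' than for e. *)

Require Import Defs.
From mathcomp Require Import all_boot all_order all_algebra.
From mathcomp Require Import all_classical all_reals all_analysis.
From mathcomp Require Import ring lra.

Set Implicit Arguments.
Unset Strict Implicit.
Unset Printing Implicit Defensive.

Import Order.TTheory GRing.Theory Num.Theory.
Import numFieldNormedType.Exports.

Local Open Scope classical_set_scope.
Local Open Scope ring_scope.

(** * Euclidean norm and angles *)

Section Plane.
Variable R : realType.
Implicit Types (u v w x y z p q : R * R) (s t : R).

Lemma pairP u v : u.1 = v.1 -> u.2 = v.2 -> u = v.
Proof. by case: u v => [? ?] [? ?] /= -> ->. Qed.

Lemma dotuu_ge0 u : 0 <= dot u u.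
Proof. by rewrite /dot addr_ge0 // -expr2 sqr_ge0. Qed.

Lemma dotuu_gt0 u : u != 0 -> 0 < dot u u.
Proof.
move=> u0; rewrite lt_neqAle dotuu_ge0 andbT eq_sym; apply: contra u0 => /eqP.
rewrite /dot => /eqP; rewrite paddr_eq0 -?expr2 ?sqr_ge0 // !sqrf_eq0.
by move=> /andP[/eqP u1 /eqP u2]; apply/eqP; exact: pairP.
Qed.

Lemma enorm_ge0 u : 0 <= enorm u. Proof. exact: sqrtr_ge0. Qed.

Lemma enorm_gt0 u : u != 0 -> 0 < enorm u.
Proof. by move=> u0; rewrite sqrtr_gt0 dotuu_gt0. Qed.

Lemma enorm_sqr u : enorm u ^+ 2 = dot u u.
Proof. by rewrite sqr_sqrtr // dotuu_ge0. Qed.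

Lemma enorm_scale s u : 0 <= s -> enorm (scale s u) = s * enorm u.
Proof.
move=> s0; rewrite /enorm [dot _ _](_ : _ = s ^+ 2 * dot u u).
  by rewrite sqrtrM ?sqr_ge0 // sqrtr_sqr ger0_norm.
by rewrite /dot /scale /=; ring.
Qed.

Lemma norm_dot_le u v : `|dot u v| <= enorm u * enorm v.
Proof.
rewrite -(@ler_pXn2r _ 2) ?nnegrE ?mulr_ge0 ?enorm_ge0 //.
rewrite exprMn !enorm_sqr -normrX ger0_norm ?sqr_ge0 //.
have := sqr_ge0 (cross u v); rewrite /cross /dot; nra.
Qed.

Lemma enormD u v : enorm (u + v) <= enorm u + enorm v.
Proof.
rewrite -(@ler_pXn2r _ 2) ?nnegrE ?addr_ge0 ?enorm_ge0 //.
rewrite enorm_sqr sqrrD !enorm_sqr.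
have := le_trans (ler_norm _) (norm_dot_le u v).
rewrite /dot /=; lra.
Qed.

Lemma norm_le_enorm u : `|u| <= enorm u.
Proof.
have sq a b : `|a| <= Num.sqrt (a * a + b * b).
  by rewrite -sqrtr_sqr ler_wsqrtr // expr2 lerDl -expr2 sqr_ge0.
by rewrite prod_normE ge_max sq /= /enorm /dot addrC sq.
Qed.

Lemma enorm_le_norm u : enorm u <= 2 * `|u|.
Proof.
have a1 : `|u.1| <= `|u| by rewrite prod_normE le_max lexx.
have a2 : `|u.2| <= `|u| by rewrite prod_normE le_max lexx orbT.
rewrite -(@ler_pXn2r _ 2) ?nnegrE ?mulr_ge0 ?enorm_ge0 //.
rewrite enorm_sqr /dot -!expr2 -[u.1 ^+ 2]ger0_norm ?sqr_ge0 //.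
rewrite -[u.2 ^+ 2]ger0_norm ?sqr_ge0 // !normrX.
have := normr_ge0 u.1; have := normr_ge0 u.2; have := normr_ge0 u.
nra.
Qed.

Lemma acos_lt : {in `[-1, 1]%R &, {homo @acos R : a b /~ a < b}}.
Proof.
move=> a b; rewrite !in_itv /= => Ia Ib ab.
have [Ja ca] := acos_def Ia; have [Jb cb] := acos_def Ib.
by rewrite -ltr_cos ?in_itv //= ca cb.
Qed.

Lemma cosine_bound u v : dot u v / (enorm u * enorm v) \in `[-1, 1]%R.
Proof.
rewrite in_itv /= -ler_norml normrM normfV.
rewrite (@ger0_norm _ (_ * _)) ?mulr_ge0 ?enorm_ge0 //.
(* If one of the vectors is zero, the quotient is 0, since the inverse of 0 is 0. *)
have [->|n0] := eqVneq (enorm u * enorm v) 0; first by rewrite invr0 mulr0.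
by rewrite ler_pdivrMr ?mul1r ?norm_dot_le // lt_neqAle eq_sym n0 mulr_ge0
  ?enorm_ge0.
Qed.

Lemma vangle_scale s u v : 0 < s -> vangle (scale s u) v = vangle u v.
Proof.
move=> s0; rewrite /vangle enorm_scale ?ltW //.
rewrite [dot (scale _ _) _](_ : _ = s * dot u v).
  by rewrite -(mulrA s (enorm u)) -mulf_div divff ?gt_eqF // mul1r.
by rewrite /dot /scale /=; ring.
Qed.

(* With A = - dot w u, B = - dot x u, X = cross x u and W = cross w u, the
   identity (dot u u) (cross w x) = A X - W B gives A X > W B, which compares
   the cosines of the two angles. *)
Lemma vangle_lt_ccw w u x : u != 0 -> dot w u <= 0 -> 0 <= cross w u ->
  0 < cross w x -> 0 < cross x u -> vangle x u < vangle w u.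
Proof.
move=> u0 wu cwu cwx cxu.
have nz z z' : 0 < cross z z' -> z != 0.
  by apply: contraTneq => ->; rewrite /cross /= !mul0r subrr ltxx.
have x0 := nz _ _ cxu; have w0 := nz _ _ cwx.
have U := dotuu_gt0 u0.
apply: acos_lt; rewrite ?cosine_bound //.
rewrite ltr_pdivrMr ?mulr_gt0 ?enorm_gt0 // mulrAC.
rewrite ltr_pdivlMr ?mulr_gt0 ?enorm_gt0 //.
rewrite !mulrA ltr_pM2r ?enorm_gt0 //.
have nx := enorm_gt0 x0; have nw := enorm_gt0 w0.
have AX : cross w u * - dot x u < - dot w u * cross x u.
  rewrite -subr_gt0 [X in _ < X](_ : _ = dot u u * cross w x) ?mulr_gt0 //.
  by rewrite /dot /cross; ring.
have [xu|xu] := ltP 0 (dot x u).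
  by apply: (@le_lt_trans _ _ 0); [nra|rewrite mulr_gt0].
rewrite -ltrN2 -!mulNr -(@ltr_pXn2r _ 2) ?nnegrE ?mulr_ge0 ?enorm_ge0
  ?oppr_ge0 //.
rewrite !exprMn !enorm_sqr.
have Ax0 : 0 <= - dot w u by rewrite oppr_ge0.
have Bx0 : 0 <= - dot x u by rewrite oppr_ge0.
have AX2 : (cross w u * - dot x u) ^+ 2 < (- dot w u * cross x u) ^+ 2.
  by rewrite ltr_pXn2r ?nnegrE ?mulr_ge0 // ltW.
rewrite -(ltr_pM2r U) -subr_gt0 [X in _ < X](_ : _ =
  (- dot w u * cross x u) ^+ 2 - (cross w u * - dot x u) ^+ 2) ?subr_gt0 //.
by rewrite /dot /cross; ring.
Qed.

(** Reflection in the first axis keeps [dot] and negates [cross], which turns this case into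
    [vangle_lt_ccw]. *)
Lemma vangle_lt_cw w u x : u != 0 -> dot w u <= 0 -> cross w u <= 0 ->
  cross w x < 0 -> cross x u < 0 -> vangle x u < vangle w u.
Proof.
pose refl v : R * R := (v.1, - v.2).
have dotE a b : dot (refl a) (refl b) = dot a b by rewrite /dot /=; ring.
have crossE a b : cross (refl a) (refl b) = - cross a b.
  by rewrite /cross /=; ring.
have angleE a b : vangle (refl a) (refl b) = vangle a b.
  by rewrite /vangle /enorm !dotE.
move=> u0 wu cwu cwx cxu; rewrite -(angleE x) -(angleE w).
apply: vangle_lt_ccw; rewrite ?dotE ?crossE ?oppr_ge0 ?oppr_gt0 //.
apply: contra u0 => /eqP[u1 /eqP]; rewrite oppr_eq0 => /eqP u2.
by apply/eqP; exact: pairP.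
Qed.

(** * Segments, lines and convex sets *)

Lemma distC p q : dist p q = dist q p.
Proof. by rewrite /dist /enorm /dot /=; congr Num.sqrt; ring. Qed.

Lemma segmentC p q : segment p q = segment q p.
Proof.
suff sub (a b : R * R) : segment a b `<=` segment b a.
  by apply/seteqP; split; exact: sub.
move=> x [t /andP[t0 t1] ->]; exists (1 - t); first by apply/andP; split; lra.
by apply: pairP; rewrite /scale /=; ring.
Qed.

Lemma open_segment_segment p q : open_segment p q `<=` segment p q.
Proof. by move=> x [t /andP[t0 t1] ->]; exists t; rewrite ?ltW. Qed.

Lemma segment_left p q : segment p q p.
Proof. by exists 0; [lra|apply: pairP; rewrite /scale /=; ring]. Qed.

Lemma segment_right p q : segment p q q.
Proof. by exists 1; [lra|apply: pairP; rewrite /scale /=; ring]. Qed.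

Lemma segment_split p q x : segment p q x ->
  x = p \/ x = q \/ open_segment p q x.
Proof.
move=> [t /andP[]]; rewrite le_eqVlt => /orP[/eqP <- _ ->|t0].
  by left; apply: pairP; rewrite /scale /=; ring.
rewrite le_eqVlt => /orP[/eqP -> ->|t1 ->].
  by right; left; apply: pairP; rewrite /scale /=; ring.
by right; right; exists t; rewrite ?t0.
Qed.

Lemma continuous_line x v : continuous (fun t => x + scale t v).
Proof.
have affine (a b s : R) : a + t * b @[t --> s] --> a + s * b.
  apply: cvgD; [exact: cvg_cst|].
  by apply: cvgM; [exact: cvg_id|exact: cvg_cst].
case: x v => [a b] [c d] s; exact: (cvg_pair (affine a c s) (affine b d s)).
Qed.

Lemma near_line x v (A : set (R * R)) : nbhs x A ->
  \forall t \near 0^'+, A (x + scale t v).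
Proof.
have x0 : x + scale 0 v = x by apply: pairP; rewrite /scale /=; ring.
rewrite -[X in nbhs X A]x0 => Ax.
exact: (@cvg_at_right_filter R _ _ _ _ (@continuous_line x v 0) A Ax).
Qed.

Lemma continuous_cross w z : continuous (fun y => cross w (y - z)).
Proof.
move=> y; rewrite /cross /=; apply: cvgB;
  (apply: cvgM; first exact: cvg_cst); apply: cvgB;
  (exact: cvg_cst || exact: cvg_fst || exact: cvg_snd).
Qed.

Lemma near_cross_gt0 w z y : 0 < cross w (y - z) ->
  \forall y' \near y, 0 < cross w (y' - z).
Proof.
move=> h; have := @continuous_cross w z y.
by move=> /cvgr_gt /(_ _ h).
Qed.

Lemma near_cross_neq0 w z y : cross w (y - z) != 0 ->
  \forall y' \near y, cross w (y' - z) != 0.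
Proof.
move=> h; have := @continuous_cross w z y.
by move=> /cvgr_neq0; apply.
Qed.

(** Induction on the directions. If the point found so far lies on the line through [p] along the
    next direction [a], a small shift along the normal of [a] leaves that line. Asking for a whole
    neighbourhood of [y] makes the earlier conditions survive the shift. *)
Lemma avoid_lines (l : seq (R * R)) p x (A : set (R * R)) : nbhs x A ->
  (forall a, a \in l -> a != 0) -> exists y : R * R,
  \forall z \near y, A z /\ forall a, a \in l -> cross a (z - p) != 0.
Proof.
elim: l => [|a l IH] Ax l0; first by exists x; apply: filterS Ax.
have [y] := IH Ax (fun b bl => l0 b (mem_behead (s := a :: l) bl)).
set Q := fun z : R * R => _ => Qy.
have a0 : a != 0 by apply: l0; rewrite mem_head.
suff [z Qz az] : exists2 z : R * R, nbhs z Q & cross a (z - p) != 0.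
  exists z; apply: filterS2 Qz (near_cross_neq0 az) => z' [Az lz] az'.
  by split=> // b; rewrite inE => /predU1P[->|] //; exact: lz.
have [ay|ay] := eqVneq (cross a (y - p)) 0; last by exists y.
have [t [t0 Qt]] :
    exists t, 0 < t /\ nbhs (y + scale t (left_normal a)) Q.
  apply: (@filter_ex _ (0^'+)).
  have Nt := near_line (left_normal a) (nbhs_interior Qy).
  by apply: filterS2 (nbhs_right_gt 0) Nt => t.
exists (y + scale t (left_normal a)) => //.
rewrite [cross _ _](_ : _ = cross a (y - p) + t * dot a a).
  by rewrite ay add0r mulf_neq0 ?gt_eqF ?dotuu_gt0.
by rewrite /cross /dot /scale /left_normal /=; ring.
Qed.

Definition convex_subset (A : set (R * R)) :=
  forall y z, A y -> A z -> segment y z `<=` A.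

Lemma convex_subsetI A B : convex_subset A -> convex_subset B ->
  convex_subset (A `&` B).
Proof.
move=> cA cB y z [Ay By] [Az Bz] x xyz.
by split; [apply: cA xyz|apply: cB xyz].
Qed.

Lemma convex_subset_ball x (r : R) : convex_subset (ball x r).
Proof.
move=> y z; rewrite -ball_normE /ball_ /= => xy xz w [t /andP[t0 t1] ->] /=.
have scaleE a v : scale a v = a *: v by [].
rewrite [x - _](_ : _ = scale (1 - t) (x - y) + scale t (x - z)); last first.
  by apply: pairP; rewrite /scale /=; ring.
rewrite !scaleE.
apply: le_lt_trans (ler_normD _ _) _.
rewrite !normrZ !ger0_norm ?subr_ge0 //.
have -> : r = (1 - t) * r + t * r by ring.
move: t0; rewrite le_eqVlt => /orP[/eqP <-|t0].
  by rewrite subr0 !mul0r !addr0 !mul1r.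
by rewrite ler_ltD ?ltr_pM2l ?ler_wpM2l ?subr_ge0 // ltW.
Qed.

Lemma convex_halfplane w z : convex_subset [set y | 0 < cross w (y - z)].
Proof.
move=> a b /= ha hb x [t /andP[t0 t1] ->] /=.
rewrite [cross _ _](_ : _ = (1 - t) * cross w (a - z) + t * cross w (b - z)).
  by nra.
by rewrite /cross /scale /=; ring.
Qed.

Lemma open_halfplane w z : open [set y | 0 < cross w (y - z)].
Proof. by rewrite openE => y /near_cross_gt0. Qed.

Lemma parallel_cross w u v : w != 0 -> cross w u = 0 -> cross w v = 0 ->
  cross u v = 0.
Proof.
move=> w0 wu wv; apply: (mulfI (lt0r_neq0 (dotuu_gt0 w0))).
rewrite mulr0 [LHS](_ : _ = dot w u * cross w v - dot w v * cross w u).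
  by rewrite wu wv !mulr0 subrr.
by rewrite /dot /cross; ring.
Qed.

Lemma segment_image p q :
  segment p q = (fun t => p + scale t (q - p)) @` `[0, 1]%classic.
Proof.
apply/seteqP; split=> x /= [t]; rewrite ?in_itv /= => t01 tx.
  by exists t; rewrite ?in_itv.
by exists t => //; move: t01; rewrite in_itv.
Qed.

Lemma segment_closed p q : closed (segment p q).
Proof.
rewrite segment_image; apply: compact_closed; first exact: norm_hausdorff.
apply: continuous_compact; last exact: segment_compact.
by apply: continuous_subspaceT; exact: continuous_line.
Qed.

Lemma segment_conn p q : connected (segment p q).
Proof.
rewrite segment_image; apply: connected_continuous_connected.
  exact: segment_connected.
by apply: continuous_subspaceT; exact: continuous_line.
Qed.

(** The parameter is the infimum of those in [0, 1] that lead into [A]. It is attained because [A]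
    is closed, and positive because [p] is outside [A]. *)
Lemma first_entry (A : set (R * R)) p v : closed A -> ~ A p -> A (p + v) ->
  exists2 s, 0 < s <= 1 & A (p + scale s v) /\
    forall t, 0 <= t < s -> ~ A (p + scale t v).
Proof.
move=> cA Ap Av; pose E := [set t | 0 <= t <= 1 /\ A (p + scale t v)].
have v1 : p + scale 1 v = p + v by apply: pairP; rewrite /scale /=; ring.
have v0 : p + scale 0 v = p by apply: pairP; rewrite /scale /=; ring.
have E1 : E 1 by split; rewrite ?v1 // ler01 lexx.
have lbE : has_lbound E by exists 0 => t [/andP[]].
have s1 : inf E <= 1 by exact: ge_inf.
have s0 : 0 <= inf E by apply: lb_le_inf; [exists 1|move=> t [/andP[]]].
have As : A (p + scale (inf E) v).
  apply: contrapT => nA; have /closed_openC := cA; rewrite openE => /(_ _ nA).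
  move=> /(@continuous_line p v (inf E)) /nbhs_ballP[e /= e0 he].
  have [t Et tlt] := inf_adherent e0 (conj (ex_intro _ 1 E1) lbE).
  case: (Et) => t01 At; apply: (he t) At; rewrite /ball /= ltr_norml.
  by have := ge_inf lbE Et; lra.
exists (inf E).
  rewrite s1 andbT lt_neqAle s0 andbT; apply/eqP => E0.
  by apply: Ap; rewrite -v0 E0.
split=> // t /andP[t0 ts] At; suff : inf E <= t by lra.
by apply: ge_inf => //; split=> //; lra.
Qed.

End Plane.

(** * Cells and faces near a point, and edges met on the way to a face *)

Section Graph.
Variables (R : realType) (G : pslg R).
Implicit Types (e : halfedge G) (v : vertex G) (f g : facet G).
Implicit Types (x y z p q : R * R) (A : set (R * R)).

Lemma edge_origin e : edge_set e (pos (origin e)).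
Proof. exact: segment_left. Qed.

Lemma edge_target e : edge_set e (pos (target e)).
Proof. exact: segment_right. Qed.

Lemma edge_twin e : edge_set (twin e) = edge_set e.
Proof. by rewrite /edge_set origin_twin target_twin segmentC. Qed.

Lemma dir_twin e : dir (twin e) = - dir e.
Proof. by rewrite /dir origin_twin target_twin opprB. Qed.

Lemma dir_neq0 e : dir e != 0.
Proof.
rewrite /dir subr_eq0; apply/eqP => h.
by apply: (@edge_nondegenerate _ _ e); apply: (@pos_inj _ G).
Qed.

Lemma cross_dir_edge e x :
  edge_set e x -> cross (dir e) (x - pos (origin e)) = 0.
Proof. by move=> [t _ ->]; rewrite /dir /cross /scale /=; ring. Qed.

Lemma bounded_ball x (r : R) : bounded_set (ball x r).
Proof.
exists (`|x| + r); split=> [|M hM y]; first exact: num_real.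
rewrite -ball_normE /ball_ /= => xy; apply: le_trans (ltW hM).
rewrite -[y](subKr x) (le_trans (ler_normB _ _)) // lerD2l ltW //.
Qed.

(** Only finitely many edges meet the unit ball around [x], so the union of those that miss [x] is
    closed, and its complement is a neighbourhood of [x]. *)
Lemma near_edges x : \forall z \near x, forall e, edge_set e z -> edge_set e x.
Proof.
pose D := [set e : halfedge G | edge_set e `&` ball x 1 !=set0].
pose F := ((@edge_set R G) @` D) `\` [set E | E x].
have Ffin : finite_set F.
  by apply/finite_setD/finite_image/finite_edges/bounded_ball.
have Fc : closed (\bigcup_(E in F) E).
  by apply: closed_bigcup => // E [[e _ <-] _]; exact: segment_closed.
have nx : ~ (\bigcup_(E in F) E) x.
  by move=> [E [_]].
have := closed_openC Fc; rewrite openE => /(_ _ nx) N1.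
have N2 : nbhs x (ball x (1 : R)) by exact: nbhsx_ballx.
apply: filterS2 N1 N2 => z nz xz e ez; apply: contrapT => ex.
apply: nz; exists (edge_set e) => //; split=> //.
by exists e => //; exists z.
Qed.

Lemma near_vertices x : \forall z \near x, forall v, pos v = z -> pos v = x.
Proof.
pose D := [set v : vertex G | ball x 1 (pos v)].
have Dfin : finite_set ((@pos R G) @` D `\ x).
  by apply/finite_setD/finite_image/finite_vertices/bounded_ball.
have Dc : closed ((@pos R G) @` D `\ x).
  apply: (accessible_finite_set_closed.1 _) Dfin.
  by apply: hausdorff_accessible; exact: norm_hausdorff.
have nx : ~ ((@pos R G) @` D `\ x) x by move=> [_]; exact.
have := closed_openC Dc; rewrite openE => /(_ _ nx) N1.
have N2 : nbhs x (ball x (1 : R)) by exact: nbhsx_ballx.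
apply: filterS2 N1 N2 => z nz xz v vz; apply: contrapT => vx.
by apply: nz; split; [exists v; rewrite /D /= ?vz|rewrite -vz].
Qed.

Local Notation cell := (connected_component (~` (@skeleton R G))).

Lemma near_skeletonC x : ~ skeleton G x -> \forall z \near x, ~ skeleton G z.
Proof.
move=> Sx; apply: filterS2 (near_edges x) (near_vertices x) => z ez vz.
move=> [[v _ vze]|[e _ eze]]; apply: Sx.
  by left; exists v => //; exact: vz.
by right; exists e => //; exact: ez.
Qed.

Lemma cell_segment x y z :
  cell x y -> segment y z `<=` ~` (@skeleton R G) -> cell x z.
Proof.
move=> xy yz; apply: connected_component_trans xy _.
exists (segment y z); last exact: segment_right.
by split=> //; [exact: segment_left|exact: segment_conn].
Qed.

Lemma cell_convex K x y :
  convex_subset K -> K `<=` ~` (@skeleton R G) -> K y -> cell x y ->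
  K `<=` cell x.
Proof.
move=> cK KS Ky xy z Kz; apply: cell_segment xy _.
by apply: subset_trans KS; exact: cK.
Qed.

Lemma cell_open x y : cell x y -> nbhs y (cell x).
Proof.
move=> xy; have Sy := connected_component_sub xy.
have /nbhs_ballP[r /= r0 yr] := near_skeletonC Sy.
apply/nbhs_ballP; exists r => //.
by apply: cell_convex (ballxx _ r0) xy => //; exact: convex_subset_ball.
Qed.

Lemma region_closed f : closed (region f).
Proof. by have [x _ ->] := region_component f; exact: closed_closure. Qed.

Lemma strictly_right_twin e p :
  strictly_right (twin e) p <-> 0 < cross (dir e) (p - pos (origin e)).
Proof.
rewrite /strictly_right dir_twin origin_twin -oppr_lt0.
suff -> : cross (- dir e) (p - pos (target e)) =
  - cross (dir e) (p - pos (origin e)) by [].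
by rewrite /dir /cross /=; ring.
Qed.

(** A face is the closure of a cell, and cells are open: points of the cell near [x] have whole
    neighbourhoods inside the face. *)
Lemma region_interior f x A : region f x -> nbhs x A ->
  exists y, nbhs y (A `&` region f).
Proof.
have [c _ ->] := region_component f => fx Ax.
have [y [cy Ay]] := fx _ (nbhs_interior Ax).
exists y; apply: filterI => //.
by apply: filterS (cell_open cy) => z; exact: subset_closure.
Qed.

Lemma open_meets_closure (T : topologicalType) (A B : set T) :
  open A -> A `&` closure B !=set0 -> A `&` B !=set0.
Proof.
move=> Ao [x [Ax Bx]]; have [|y [By Ay]] := Bx A; last by exists y.
exact: open_nbhs_nbhs.
Qed.

(** An open set that meets the closure of a cell meets the cell itself, and a convex set off the
    skeleton never leaves a cell that it meets. *)
Lemma region_convex K f : open K -> convex_subset K ->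
  K `<=` ~` (@skeleton R G) -> K `&` region f !=set0 -> K `<=` region f.
Proof.
move=> Ko cK KS; have [c _ ->] := region_component f.
move=> /(open_meets_closure Ko)[y [Ky cy]] z Kz.
by apply: subset_closure; exact: (cell_convex cK KS Ky cy).
Qed.

Lemma region_convex_inj K f g : open K -> convex_subset K ->
  K `<=` ~` (@skeleton R G) -> K `&` region f !=set0 -> K `&` region g !=set0 ->
  f = g.
Proof.
move=> Ko cK KS Kf Kg; apply: (@region_inj R G); move: Kf Kg.
have [c _ ->] := region_component f; have [d _ ->] := region_component g.
move=> /(open_meets_closure Ko)[y [Ky cy]] /(open_meets_closure Ko)[z [Kz dz]].
have cz := cell_convex cK KS Ky cy Kz.
by rewrite (same_connected_component cz) (same_connected_component dz).
Qed.

(** Near [z] the skeleton stays on the line of [e], so each half of a small ball lies in a single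
    cell. The right half contains points outside [f], hence misses [f]; as [f] has interior points
    near [z], it must meet the left half. So does [face e], by [face_left], and the two faces
    coincide. *)
Lemma boundary_face e f z : edge_set e z -> (forall v, pos v <> z) ->
  region f z ->
  (forall A, nbhs z A ->
    exists y, [/\ A y, ~ region f y & strictly_right e y]) ->
  face e = f.
Proof.
move=> ez vz fz right_outside.
have [zo|[zt|oz]] := segment_split ez; first by case: (vz (origin e)).
  by case: (vz (target e)).
pose o := pos (origin e).
have flat : \forall y \near z, skeleton G y -> cross (dir e) (y - o) = 0.
  apply: filterS2 (near_edges z) (near_vertices z) => y ey vy.
  move=> [[v _ vE]|[g _ gy]]; first by case: (vz v); exact: vy.
  have := edges_planar ez (ey _ gy) => -[ge|[ge|[v [vE _]]]].
  - by apply: cross_dir_edge; rewrite -ge.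
  - by apply: cross_dir_edge; rewrite -edge_twin -ge.
  - by case: (vz v).
have /nbhs_ballP[r /= r0 zr] := flat.
pose half w := ball z r `&` [set y | 0 < cross w (y - o)].
have half_open w : open (half w).
  by apply: openI; [exact: ball_open|exact: open_halfplane].
have half_convex w : convex_subset (half w).
  by apply: convex_subsetI; [exact: convex_subset_ball|exact: convex_halfplane].
have crossN u : cross (- dir e) u = - cross (dir e) u.
  by rewrite /cross /=; ring.
have left_cell : half (dir e) `<=` ~` (@skeleton R G).
  by move=> y [zy /= h] Sy; move: h; rewrite (zr _ zy Sy) ltxx.
have right_cell : half (- dir e) `<=` ~` (@skeleton R G).
  by move=> y [zy /= h] Sy; move: h; rewrite crossN (zr _ zy Sy) oppr0 ltxx.
have zball : nbhs z (ball z r) by exact: nbhsx_ballx.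
have left_f : half (dir e) `&` region f !=set0.
  have [y yf] := region_interior fz zball.
  have dirs a : a \in [:: dir e] -> a != 0.
    by rewrite inE => /eqP ->; exact: dir_neq0.
  (* The interior of [f] near [z] contains a point [c] off the line of [e]. *)
  have [c /nbhs_singleton[[zc fc] /(_ _ (mem_head _ _)) c0]] :=
    avoid_lines o yf dirs.
  exists c; split=> //; split=> //=.
  rewrite lt_neqAle eq_sym c0 /= leNgt; apply/negP => cneg.
  have [y' [zy' fy' ry']] := right_outside _ zball.
  apply: fy'; apply: (region_convex (half_open _) (half_convex _) right_cell).
    by exists c; split=> //; split=> //=; rewrite crossN oppr_gt0.
  by split=> //=; rewrite crossN oppr_gt0.
have left_e : half (dir e) `&` region (face e) !=set0.
  have [t [t0 [zt ft]]] : exists t, 0 < t /\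
      (ball z r (z + scale t (left_normal (dir e))) /\
       region (face e) (z + scale t (left_normal (dir e)))).
    apply: (@filter_ex _ (0^'+)).
    have Nt := near_line (left_normal (dir e)) zball.
    apply: filterS3 (nbhs_right_gt 0) Nt (face_left oz) => t.
    by split.
  exists (z + scale t (left_normal (dir e))); split=> //; split=> //=.
  rewrite [cross _ _](_ : _ = cross (dir e) (z - o) + t * dot (dir e) (dir e)).
    by rewrite /o cross_dir_edge // add0r mulr_gt0 // dotuu_gt0 // dir_neq0.
  by rewrite /cross /dot /scale /left_normal /=; ring.
apply: region_convex_inj left_cell left_e left_f; first exact: half_open.
exact: half_convex.
Qed.

(** Here [y] is a point of [f] near [x] in general position with respect to [p], and [s] is the
    parameter at which the segment from [p] to [y] first enters [f]. *)
Lemma crossing f p x A : region f x -> nbhs x A -> ~ region f p ->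
  exists y s e, [/\ A y, 0 < s <= 1, face e = f,
    open_segment (pos (origin e)) (pos (target e)) (p + scale s (y - p)) &
    strictly_right e p].
Proof.
move=> fx Ax fp.
pose B := ball p (`|x - p| + 1).
pose E := [set e : halfedge G | edge_set e `&` B !=set0].
pose V := [set v : vertex G | B (pos v)].
(* The endpoints of edges meeting [B] are listed separately, since they may lie outside [B]. *)
pose P := (pos \o origin) @` E `|` (pos \o target) @` E `|` pos @` V.
have Pfin : finite_set (P `\ p).
  have Efin : finite_set E by apply/finite_edges/bounded_ball.
  apply/finite_setD; rewrite !finite_setU; do !split; apply: finite_image => //.
  by apply/finite_vertices/bounded_ball.
have [l lP] := (finite_seqP _).1 Pfin.
have BA : nbhs x (A `&` B).
  apply: filterI => //; apply: open_nbhs_nbhs; split; first exact: ball_open.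
  by rewrite /B -ball_normE /ball_ /= distrC ltrDl.
have [y0 y0A] := region_interior fx BA.
have [] := @avoid_lines _ [seq a - p | a <- l] p _ _ y0A.
  move=> _ /mapP[a al ->]; rewrite subr_eq0; apply/eqP => ap.
  have : [set` l] a by [].
  by rewrite -lP ap => -[_]; apply.
move=> y /nbhs_singleton[[[Ay By] fy] yl].
have generic a : P a -> a <> p -> cross (a - p) (y - p) != 0.
  move=> Pa ap; apply: yl; apply: map_f.
  by have : (P `\ p) a by []; rewrite lP.
have py : region f (p + (y - p)) by rewrite addrC subrK.
have [s s01 [fz before]] := first_entry (@region_closed f) fp py.
have [s0 s1] := andP s01.
set z := p + scale s (y - p) in fz.
have Bz : B z.
  apply: (@convex_subset_ball _ _ _ p y) => //.
    by apply: ballxx; rewrite ltr_wpDl.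
  by exists s; rewrite ?(ltW s0).
have step_back N : nbhs z N ->
    exists t, [/\ 0 < t, N (z + scale t (p - y)) &
      ~ region f (z + scale t (p - y))].
  move=> Nz; apply: (@filter_ex _ (0^'+)).
  have Nt := near_line (p - y) Nz.
  apply: filterS3 (nbhs_right_gt 0) (nbhs_right_lt s0) Nt => t t0 ts Nzt.
  split=> //; rewrite [z + _](_ : _ = p + scale (s - t) (y - p)).
    by apply: before; lra.
  by apply: pairP; rewrite /z /scale /=; ring.
have zp : z <> p by move=> zp; apply: fp; rewrite -zp.
have vz v : pos v <> z.
  move=> vE; have Pz : P z by right; exists v; rewrite /V /= ?vE.
  have /eqP := generic z Pz zp; apply.
  by rewrite /z /cross /scale /=; ring.
(* Otherwise a ball around [z] would avoid the skeleton and lie wholly in [f], although points just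
   before [z] are outside [f]. *)
have [[v _ /vz//]|[e0 _ e0z]] : skeleton G z.
  apply: contrapT => Sz; have /nbhs_ballP[r /= r0 zr] := near_skeletonC Sz.
  have zball : nbhs z (ball z r) by exact: nbhsx_ballx.
  have [t [_ zt]] := step_back _ zball; apply.
  apply: (region_convex (@ball_open _ _ z r) _ zr) zt.
    exact: convex_subset_ball.
  by exists z; split=> //; exact: ballxx.
(* If [p] were on the line of [e0], so would be [y], and an endpoint of [e0] other than [p] would be
   aligned with [p] and [y], against [generic]. *)
have off_line : cross (dir e0) (p - pos (origin e0)) != 0.
  apply/eqP => p_on.
  have z_on := cross_dir_edge e0z.
  have dy : cross (dir e0) (y - p) = 0.
    apply: (mulfI (lt0r_neq0 s0)); rewrite mulr0 -[RHS](subrr 0) -{1}z_on -p_on.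
    by rewrite /z /cross /scale /=; ring.
  have Ee0 : E e0 by exists z.
  have [op|/eqP op] := eqVneq (pos (origin e0)) p.
    have tp : pos (target e0) <> p.
      by rewrite -op => /pos_inj /esym; exact: edge_nondegenerate.
    have Pt : P (pos (target e0)) by left; right; exists e0.
    have /eqP := generic _ Pt tp; apply.
    apply: (parallel_cross (dir_neq0 e0)) => //.
    by rewrite -op /cross /dir; ring.
  have Po : P (pos (origin e0)) by left; left; exists e0.
  have /eqP := generic _ Po op; apply.
  apply: (parallel_cross (dir_neq0 e0)) => //.
  by rewrite -[RHS]oppr0 -p_on /cross /=; ring.
have [e [ez pe]] : exists e, edge_set e z /\ strictly_right e p.
  move: off_line; rewrite neq_lt => /orP[h|h]; first by exists e0.
  by exists (twin e0); rewrite edge_twin strictly_right_twin.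
have ze := cross_dir_edge ez.
exists y, s, e; split=> //.
  apply: (boundary_face ez vz fz) => N Nz.
  have [t [t0 Nt ft]] := step_back _ Nz.
  exists (z + scale t (p - y)); split=> //; rewrite /strictly_right.
  (* As [z] is on the line of [e], the points just before [z] are on the same side of it as [p]. *)
  rewrite -(pmulr_rlt0 _ s0) [X in X < 0](_ : _ =
    (s - t) * cross (dir e) (z - pos (origin e)) +
    t * cross (dir e) (p - pos (origin e))).
    by rewrite ze mulr0 add0r pmulr_rlt0.
  by rewrite /z /cross /scale /=; ring.
have [zo|[zt|//]] := segment_split ez; first by case: (vz (origin e)).
by case: (vz (target e)).
Qed.

End Graph.

(** * Closest points, wide angles and the step to a closer edge *)

Section Walk.
Variables (R : realType) (G : pslg R).
Implicit Types (e : halfedge G) (p q x y z u w : R * R).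

Lemma distE p q : dist p q = Num.sqrt (dot (p - q) (p - q)).
Proof. by rewrite distC. Qed.

Lemma le_dist p q z :
  (dist p q <= dist p z) = (dot (p - q) (p - q) <= dot (p - z) (p - z)).
Proof. by rewrite !distE ler_sqrt // dotuu_ge0. Qed.

Lemma is_closest_exists e p : exists q, is_closest e p q.
Proof.
pose a := pos (origin e); pose c := dot (p - a) (dir e).
have n0 : 0 < dot (dir e) (dir e) by rewrite dotuu_gt0 ?dir_neq0.
have expand t : dot (p - (a + scale t (dir e))) (p - (a + scale t (dir e))) =
    dot (p - a) (p - a) - t * c *+ 2 + t ^+ 2 * dot (dir e) (dir e).
  by rewrite /c /dot /scale /=; ring.
suff [t t01 tmin] : exists2 t, 0 <= t <= 1 & forall s, 0 <= s <= 1 ->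
    t ^+ 2 * dot (dir e) (dir e) - t * c *+ 2 <=
    s ^+ 2 * dot (dir e) (dir e) - s * c *+ 2.
  exists (a + scale t (dir e)); split; first by exists t.
  move=> _ [s s01 ->]; rewrite le_dist !expand.
  by have := tmin s s01; lra.
(* The minimiser is the vertex [c / dot (dir e) (dir e)] of the quadratic, clamped to [0, 1]. *)
have [c0|c0] := leP c 0.
  exists 0 => [|s /andP[s0 s1]]; first lra.
  have := mulr_ge0 (sqr_ge0 s) (ltW n0); have := mulr_ge0_le0 s0 c0; lra.
have [nc|nc] := leP (dot (dir e) (dir e)) c.
  exists 1 => [|s /andP[s0 s1]]; first lra.
  have := mulr_ge0 (sqr_ge0 (1 - s)) (ltW n0).
  have : 0 <= (1 - s) * (c - dot (dir e) (dir e)) by rewrite mulr_ge0 ?subr_ge0.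
  nra.
exists (c / dot (dir e) (dir e)) => [|s _].
  by rewrite divr_ge0 ?(ltW c0) ?(ltW n0) //= ler_pdivrMr // mul1r ltW.
rewrite -subr_ge0 [X in _ <= X](_ : _ =
  dot (dir e) (dir e) * (s - c / dot (dir e) (dir e)) ^+ 2).
  by rewrite mulr_ge0 ?sqr_ge0 // ltW.
by field; rewrite gt_eqF.
Qed.

Lemma closestP e p : is_closest e p (closest e p).
Proof. exact: xgetPex (is_closest_exists e p). Qed.

Lemma is_closest_obtuse e p q z : is_closest e p q -> edge_set e z ->
  dot (p - q) (z - q) <= 0.
Proof.
move=> [eq qmin] ez; rewrite leNgt; apply/negP => acute.
have zq : z - q != 0.
  by apply: contraTneq acute => ->; rewrite /dot /= !mulr0 addr0 ltxx.
have n0 := dotuu_gt0 zq.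
(* The bound 1 keeps the moved point on the edge; the other bound makes the squared distance drop by
   at least [t] times the inner product assumed positive. *)
pose t := Num.min 1 (dot (p - q) (z - q) / dot (z - q) (z - q)).
have t0 : 0 < t by rewrite lt_min ltr01 divr_gt0.
have t1 : t <= 1 by rewrite ge_min lexx.
have tn : t * dot (z - q) (z - q) <= dot (p - q) (z - q).
  by rewrite -ler_pdivlMr // ge_min lexx orbT.
have : edge_set e (q + scale t (z - q)).
  move: eq ez => [a /andP[a0 a1] ->] [b /andP[b0 b1] ->].
  exists (a + t * (b - a)); first by apply/andP; split; nra.
  by apply: pairP; rewrite /scale /=; ring.
move=> /qmin; rewrite le_dist leNgt => /negP; apply; rewrite -subr_gt0.
rewrite [X in _ < X](_ : _ =
  t * (dot (p - q) (z - q) *+ 2 - t * dot (z - q) (z - q))).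
  by rewrite mulr_gt0 //; lra.
by rewrite /dot /scale /=; ring.
Qed.

(** The two nonpositive inner products given by [is_closest_obtuse] add up to the squared length of
    [q - q']. *)
Lemma is_closest_unique e p q q' :
  is_closest e p q -> is_closest e p q' -> q = q'.
Proof.
move=> cq cq'; apply/eqP; rewrite -subr_eq0; apply/negPn/negP => /dotuu_gt0.
have := is_closest_obtuse cq cq'.1; have := is_closest_obtuse cq' cq.1.
by rewrite /dot /=; lra.
Qed.

Lemma closestE e p q : is_closest e p q -> closest e p = q.
Proof. exact: is_closest_unique (closestP e p). Qed.

Lemma closest_twin e p : closest (twin e) p = closest e p.
Proof. by apply: closestE; rewrite /is_closest edge_twin; exact: closestP. Qed.

Lemma wide_angle_origin e p :
  wide_angle e p (pos (origin e)) = vangle (dir e) (p - pos (origin e)).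
Proof. by rewrite /wide_angle eqxx. Qed.

Lemma pos_target_neq e : pos (target e) != pos (origin e).
Proof. by have := dir_neq0 e; rewrite subr_eq0. Qed.

Lemma wide_angle_target e p :
  wide_angle e p (pos (target e)) = vangle (- dir e) (p - pos (target e)).
Proof. by rewrite /wide_angle (negPf (pos_target_neq e)) eqxx /dir opprB. Qed.

Lemma wide_angle_twin e p q : wide_angle (twin e) p q = wide_angle e p q.
Proof.
rewrite /wide_angle origin_twin target_twin maxC.
have [->|//] := eqVneq q (pos (target e)).
by rewrite (negPf (pos_target_neq e)).
Qed.

Lemma celestial_twin e p : celestial (twin e) p = celestial e p.
Proof. by rewrite /celestial closest_twin wide_angle_twin. Qed.

(** An interior point of the edge gives its direction as seen from either endpoint, so the two
    orientations can be treated alike. *)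
Lemma wide_angle_ray e p v x : v = origin e \/ v = target e ->
  open_segment (pos (origin e)) (pos (target e)) x ->
  wide_angle e p (pos v) = vangle (x - pos v) (p - pos v).
Proof.
move=> [->|->] [t /andP[t0 t1] ->].
  rewrite wide_angle_origin -(vangle_scale (dir e) _ t0).
  by congr vangle; rewrite /dir; apply: pairP; rewrite /scale /=; ring.
have t1' : 0 < 1 - t by rewrite subr_gt0.
rewrite wide_angle_target -(vangle_scale (- dir e) _ t1').
by congr vangle; rewrite /dir; apply: pairP; rewrite /scale /=; ring.
Qed.

(** Interior points of the edge are limits of points just to its left, which are in the closed face;
    any point of the edge is a limit of interior points, reached by moving towards the midpoint
    [m]. *)
Lemma edge_region e : edge_set e `<=` region (face e).
Proof.
have sub_open :
    open_segment (pos (origin e)) (pos (target e)) `<=` region (face e).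
  move=> x ox; apply: region_closed => A Ax.
  have At := near_line (left_normal (dir e)) Ax.
  suff [t] :
      exists t, (region (face e) `&` A) (x + scale t (left_normal (dir e))).
    by exists (x + scale t (left_normal (dir e))).
  by apply: (@filter_ex _ (0^'+)); apply: filterS2 (face_left ox) At.
pose m := pos (origin e) + scale (2^-1) (dir e).
move=> x [t /andP[t0 t1] ->]; apply: region_closed => A Ax.
have [s [s0 s1 As]] : exists s, [/\ 0 < s, s < 1 &
    A (pos (origin e) + scale t (dir e) +
       scale s (m - (pos (origin e) + scale t (dir e))))].
  apply: (@filter_ex _ (0^'+)).
  apply: filterS3 (nbhs_right_gt 0) (nbhs_right_lt ltr01) (near_line _ Ax).
  by move=> s s0 s1 As; split=> //; exact: As.
eexists; split; last exact: As.
apply: sub_open; exists (t + s * (2^-1 - t)).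
  by apply/andP; split; nra.
by rewrite /m; apply: pairP; rewrite /scale /=; ring.
Qed.

(** Both terms are nonnegative, and by Lagrange's identity [cross w u] and [dot w u] cannot vanish
    together. This will place a point strictly inside the angle at an endpoint of an edge, with [c]
    the absolute value of the inner product. *)
Lemma cone_pos w u (a b c : R) : w != 0 -> u != 0 -> 0 < a -> 0 < b ->
  0 <= cross w u -> 0 <= c -> c ^+ 2 = dot w u ^+ 2 ->
  0 < a * cross w u + b * c.
Proof.
move=> w0 u0 a0 b0 k0 c0 ce.
have ak : 0 <= a * cross w u by rewrite mulr_ge0 // ltW.
have bc : 0 <= b * c by rewrite mulr_ge0 // ltW.
rewrite lt_neqAle eq_sym addr_ge0 // andbT.
rewrite paddr_eq0 // !mulf_eq0 (gt_eqF a0) (gt_eqF b0) /=.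
apply/negP => /andP[/eqP ku /eqP c00].
have : 0 < dot w w * dot u u by rewrite mulr_gt0 ?dotuu_gt0.
rewrite [X in _ < X](_ : _ = dot w u ^+ 2 + cross w u ^+ 2).
  by rewrite -ce ku c00 expr0n addr0 ltxx.
by rewrite /dot /cross; ring.
Qed.

(** The point is at most [dist p y - dist p q] away from [y], hence at most [dist y q]. This puts it
    within [2 * dist y q] of [q], and comparing [enorm] with the max norm costs another factor 2. *)
Lemma dist_on_segment p q y (s : R) : 0 <= s <= 1 ->
  dist p q <= dist p (p + scale s (y - p)) ->
  `|p + scale s (y - p) - q| <= 4 * `|y - q|.
Proof.
move=> /andP[s0 s1]; rewrite /dist addrAC subrr add0r enorm_scale // => far.
apply: le_trans (norm_le_enorm _) _.
rewrite [X in enorm X](_ : _ = scale (1 - s) (p - y) + (y - q)); last first.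
  by apply: pairP; rewrite /scale /=; ring.
apply: le_trans (enormD _ _) _; rewrite enorm_scale ?subr_ge0 //.
have py : enorm (p - y) = enorm (y - p) := distC y p.
have tri : enorm (y - p) <= enorm (y - q) + enorm (q - p).
  by have := enormD (y - q) (q - p); rewrite addrA subrK.
have := enorm_le_norm (y - q); rewrite py; nra.
Qed.

Lemma exists_closer_edge e p : ~ strictly_right e p -> ~ region (face e) p ->
  exists e', [/\ face e' = face e,
    celestial_lt (celestial e' p) (celestial e p) & strictly_right e' p].
Proof.
move=> /negP; rewrite -leNgt => left_p pf.
set o := pos (origin e) in left_p.
have cq := closestP e p; set q := closest e p in cq; set u := p - q.
have [eq _] := cq.
have pq : p != q by apply: contra_notN pf => /eqP ->; exact: edge_region.
have u0 : u != 0 by rewrite subr_eq0.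
have d0 : dir e != 0 := dir_neq0 e.
(* Every edge that meets the ball of radius [r] contains [q]; the radius [r / 4] absorbs the factor
   of [dist_on_segment]. *)
have /nbhs_ballP[r /= r0 qr] := near_edges G q.
have r40 : 0 < r / 4 by rewrite divr_gt0.
(* When [q] is an endpoint of [e], the last two conditions put [y - q] strictly inside the angle
   between the edge and [u]; the turn is counter-clockwise at the origin and clockwise at the
   target. *)
pose A := [set y | [/\ ball q (r / 4) y, 0 < cross (dir e) (y - o),
  q = o -> 0 < cross (- u) (y - q) &
  q = pos (target e) -> 0 < cross u (y - q)]].
have [x0 fx0 Ax0] : exists2 x0, region (face e) x0 & nbhs x0 A.
  (* The witness goes from [q] slightly towards the midpoint [m], into the open edge, and then
     slightly to the left, into the face. *)
  pose m := o + scale (2^-1) (dir e).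
  have bq : nbhs q (ball q (r / 4)) by exact: nbhsx_ballx.
  have [a [a0 a1 qa]] : exists a, [/\ 0 < a, a < 1 &
      ball q (r / 4) (q + scale a (m - q))].
    apply: (@filter_ex _ (0^'+)).
    apply: filterS3 (nbhs_right_gt 0) (nbhs_right_lt ltr01) (near_line _ bq).
    by move=> a a0 a1 qa; split=> //; exact: qa.
  set z := q + scale a (m - q) in qa.
  have oz : open_segment o (pos (target e)) z.
    rewrite /z; case: eq => t /andP[t0 t1] ->; exists (t + a * (2^-1 - t)).
      by apply/andP; split; nra.
    by rewrite /m; apply: pairP; rewrite /scale /=; ring.
  have bz : nbhs z (ball q (r / 4)).
    by apply: open_nbhs_nbhs; split=> //; exact: ball_open.
  pose n := left_normal (dir e).
  have [t [t0 zt ft]] : exists t, [/\ 0 < t, ball q (r / 4) (z + scale t n) &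
      region (face e) (z + scale t n)].
    apply: (@filter_ex _ (0^'+)).
    apply: filterS3 (nbhs_right_gt 0) (near_line n bz) (face_left oz) => t.
    by split.
  exists (z + scale t n) => //.
  have near_imp (P : Prop) (Q : set (R * R)) :
      (P -> nbhs (z + scale t n) Q) -> nbhs (z + scale t n) [set y | P -> Q y].
    move=> PQ; have [HP|HP] := pselect P; last by apply: filterE => y ?.
    by apply: filterS (PQ HP) => y Qy _.
  have N1 : nbhs (z + scale t n) (ball q (r / 4)).
    by apply: open_nbhs_nbhs; split=> //; exact: ball_open.
  have N2 : nbhs (z + scale t n) [set y | 0 < cross (dir e) (y - o)].
    apply: near_cross_gt0.
    have [b _ ->] := oz.
    rewrite [cross _ _](_ : _ = t * dot (dir e) (dir e)).
      by rewrite mulr_gt0 // dotuu_gt0.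
    by rewrite /n /o /dir /cross /dot /scale /left_normal /=; ring.
  have a2 : 0 < a / 2 by rewrite divr_gt0.
  have N3 : nbhs (z + scale t n) [set y | q = o -> 0 < cross (- u) (y - q)].
    apply: near_imp => qo; apply: near_cross_gt0.
    have ob := is_closest_obtuse cq (edge_target e).
    rewrite [cross _ _](_ : _ = a / 2 * cross (dir e) u + t * - dot (dir e) u).
      apply: cone_pos => //; last by rewrite sqrrN.
        by rewrite /u qo.
      rewrite oppr_ge0; move: ob; rewrite qo -/(dir e) -qo -/u.
      by rewrite /dot mulrC [X in _ + X]mulrC.
    by rewrite /z /m -qo /n /cross /dot /scale /left_normal /=; field.
  have N4 : nbhs (z + scale t n)
      [set y | q = pos (target e) -> 0 < cross u (y - q)].
    apply: near_imp => qt; apply: near_cross_gt0.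
    have ob := is_closest_obtuse cq (edge_origin e).
    rewrite [cross _ _](_ : _ = a / 2 * cross (dir e) u + t * dot (dir e) u).
      apply: cone_pos => //.
        by move: left_p; rewrite /u qt /o /dir /cross /=; lra.
      by move: ob; rewrite -/u qt /dir /dot /=; lra.
    by rewrite /z /m qt /n /o /dir /cross /dot /scale /left_normal /=; field.
  apply: filterS2 (filterI N1 N2) (filterI N3 N4) => y [? ?] [? ?].
  by split.
have [y [s [e' [[qy ey yo yt] /andP[s0 s1] fe' oe' re']]]] :=
  crossing fx0 Ax0 pf.
set x := p + scale s (y - p) in oe'.
exists e'; split=> //.
have ex : edge_set e' x by exact: open_segment_segment.
have [_ /(_ _ ex) le_x] := closestP e' p.
rewrite /celestial_lt /celestial -/q.
have [near|far] := ltP (dist p (closest e' p)) (dist p q); first by left.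
(* Now [x] is no closer to [p] than [q] is, so it lies within [r] of [q]. *)
have e'q : edge_set e' q.
  apply: (qr x) => //; rewrite -ball_normE /ball_ /= distrC.
  have s01 : 0 <= s <= 1 by rewrite s1 ltW.
  apply: le_lt_trans (dist_on_segment s01 (le_trans far le_x)) _.
  rewrite mulrC -ltr_pdivlMr // distrC.
  by move: qy; rewrite -ball_normE.
have q_closest : is_closest e' p q.
  split=> // z e'z; apply: (le_trans far).
  by have [_] := closestP e' p; exact.
right; rewrite (closestE q_closest); split=> //=.
have /negPf -> : dist p q != 0.
  by rewrite distC /dist gt_eqF // enorm_gt0.
(* The point [x] is a convex combination of [p], not right of [e], and [y], strictly left of [e] and
   of positive weight. *)
have left_x : 0 < cross (dir e) (x - o).
  rewrite [cross _ _](_ : _ =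
    (1 - s) * cross (dir e) (p - o) + s * cross (dir e) (y - o)).
    by rewrite ltr_wpDl ?mulr_gt0 // mulr_ge0 // subr_ge0.
  by rewrite /x /cross /scale /=; ring.
have ne_x : ~ edge_set e x.
  by move=> /cross_dir_edge x_on; rewrite x_on ltxx in left_x.
have [e'e|[e'e|[v [vq ve ve']]]] := edges_planar eq e'q.
- by case: ne_x; rewrite -e'e.
- by case: ne_x; rewrite -edge_twin -e'e.
rewrite -vq (wide_angle_ray _ ve' oe') vq -/u.
have xu : cross (x - q) u = s * cross (y - q) u.
  by rewrite /x /u /cross /scale /=; ring.
have ob z : edge_set e z -> dot (z - q) u <= 0.
  by move=> /(is_closest_obtuse cq); rewrite /u /dot mulrC [X in _ + X]mulrC.
have [vo|vt] := ve.
  have qo : q = o by rewrite -vq vo.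
  rewrite qo -/o wide_angle_origin -/o -qo -/u.
  apply: vangle_lt_ccw => //.
  - by rewrite /dir -/o -qo; exact/ob/edge_target.
  - by rewrite /u qo.
  - by rewrite qo.
  - rewrite xu mulr_gt0 //; have := yo qo.
    by rewrite /cross /=; lra.
have qt : q = pos (target e) by rewrite -vq vt.
rewrite qt wide_angle_target -qt -/u.
apply: vangle_lt_cw => //.
- by rewrite /dir opprB -qt; exact/ob/edge_origin.
- by move: left_p; rewrite /u qt /o /dir /cross /=; lra.
- by move: left_x; rewrite qt /o /dir /cross /=; lra.
- rewrite xu pmulr_rlt0 //; have := yt qt.
  by rewrite /cross /=; lra.
Qed.

(** * Termination and the loop invariant *)

Lemma celestial_lt_irr (D : R * R) : ~ celestial_lt D D.
Proof. by case=> [|[_]]; rewrite ltxx. Qed.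

Lemma celestial_lt_trans (D1 D2 D3 : R * R) :
  celestial_lt D1 D2 -> celestial_lt D2 D3 -> celestial_lt D1 D3.
Proof.
move=> [a|[a b]] [c|[c d]].
- by left; exact: lt_trans c.
- by left; rewrite -c.
- by left; rewrite a.
- by right; split; [rewrite a|exact: lt_trans d].
Qed.

(** Passing to the twin keeps the celestial distance and exchanges the two sides. *)
Lemma candidates_lt p e e' : candidates p e e' ->
  celestial_lt (celestial e' p) (celestial e p) /\ ~ strictly_right e' p.
Proof.
move=> [e1 [_ lt1 right1] <-]; rewrite celestial_twin; split=> //.
move=> /strictly_right_twin; move: right1; rewrite /strictly_right => h1 h2.
by have := lt_trans h1 h2; rewrite ltxx.
Qed.

Lemma initial_edge_left einit p :
  ~ strictly_right (@initial_edge R G einit p) p.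
Proof.
rewrite /initial_edge; case: asboolP => // right1 /strictly_right_twin.
by move: right1; rewrite /strictly_right => h1 /(lt_trans h1); rewrite ltxx.
Qed.

(** A descent never repeats an edge, yet all its edges meet one ball around [p]. *)
Lemma no_celestial_descent p (e : nat -> halfedge G) :
  ~ forall n, celestial_lt (celestial (e n.+1) p) (celestial (e n) p).
Proof.
move=> desc.
have lt_desc m n : (m < n)%N ->
    celestial_lt (celestial (e n) p) (celestial (e m) p).
  elim: n => // n IH; rewrite ltnS leq_eqVlt => /predU1P[->//|/IH].
  exact: celestial_lt_trans (desc n).
have e_inj : injective e.
  move=> m n emn; have [mn|nm|//] := ltngtP m n.
    by have := lt_desc _ _ mn; rewrite emn => /celestial_lt_irr.
  by have := lt_desc _ _ nm; rewrite emn => /celestial_lt_irr.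
have Bfin := finite_edges G (bounded_ball p (dist p (closest (e 0%N) p) + 1)).
apply: infinite_nat; have := finite_preimage (in2W e_inj) Bfin.
(* The closest point of each edge is the witness; the 1 added to the radius makes up for the ball
   being open. *)
apply: sub_finite_set => n _ /=; exists (closest (e n) p); split.
  by have [] := closestP (e n) p.
rewrite -ball_normE /ball_ /= distrC.
apply: le_lt_trans (norm_le_enorm _) _; rewrite -/(dist _ _).
apply: (@le_lt_trans _ _ (dist p (closest (e 0%N) p))); last by rewrite ltrDl.
case: n => [//|n]; have [|[+ _]] := lt_desc 0%N n.+1 isT.
  exact: ltW.
by rewrite /celestial /= => ->.
Qed.

(** An empty set of choices can only come from an iteration, whose current edge was drawn from the
    preceding set and so does not have [p] strictly on its right. *)
Lemma reachable_inv (einit : halfedge G) p (s : state G) :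
  reachable einit p s ->
  (forall e, s.2 e -> ~ strictly_right e p) /\
  (s.2 = set0 -> s.2 = candidates p s.1 /\ ~ strictly_right s.1 p).
Proof.
elim=> [|s1 s2 _ [left1 _] [s12 ->]].
  split=> [e ->|]; first exact: initial_edge_left.
  by rewrite -subset0 => /(_ _ erefl).
by split=> [e /candidates_lt[]|_]; last by split=> //; exact: left1.
Qed.

End Walk.

Theorem theorem1 (R : realType) (G : pslg R) (einit : halfedge G)
  (p : (R * R)%type) :
  (~ exists run : nat -> state G, infinite_run einit p run) /\
  (forall s : state G, reachable einit p s -> s.2 = set0 ->
     region (face s.1) p).
Proof.
split.
  move=> [run [_ step]].
  (* The sequence starts at index 1: the first iteration draws from the initial singleton, and only
     later ones draw from [candidates]. *)
  apply: (@no_celestial_descent _ _ p (fun n => (run n.+1).1)) => n.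
  have [_ run2] := step n; have [+ _] := step n.+1.
  by rewrite run2 => /candidates_lt[].
move=> s /reachable_inv[_ inv] s0; have [cand left_s] := inv s0.
apply: contrapT => /(exists_closer_edge left_s)[e [fe lt_e right_e]].
suff : s.2 (twin e) by rewrite s0.
by rewrite cand; exists e.
Qed.
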